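(* Let $I\subset[0,\infty)$ be an interval, let $a,b\in I$ with $a<b$, and let $f,g:I\to\mathbb{R}$ be functions such that $f$, $g$ and $fg$ are in $L^{1}([a,b])$. Suppose that $f$ is convex on $[a,b]$ and that $g$ is $s$-convex in the second sense on $[a,b]$ for some $s\in(0,1]$. Then $$ \begin{aligned} &\frac{f(a)}{(b-a)^{2}}\int_{a}^{b}(b-x)\,g(x)\,dx+\frac{f(b)}{(b-a)^{2}}\int_{a}^{b}(x-a)\,g(x)\,dx\\ &\quad+\frac{g(a)}{(b-a)^{s+1}}\int_{a}^{b}(b-x)^{s}f(x)\,dx+\frac{g(b)}{(b-a)^{s+1}}\int_{a}^{b}(x-a)^{s}f(x)\,dx\\ &\le \frac{1}{b-a}\int_{a}^{b}f(x)g(x)\,dx+\frac{M(a,b)}{s+2}+\frac{N(a,b)}{(s+1)(s+2)}, \end{aligned} $$ where $M(a,b)=f(a)g(a)+f(b)g(b)$ and $N(a,b)=f(a)g(b)+f(b)g(a)$.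
   Context: For a fixed $s\in(0,1]$, a real-valued function $h$ is $s$-convex in the second sense on an interval $J\subset[0,\infty)$ if $h(tx+(1-t)y)\le t^{s}h(x)+(1-t)^{s}h(y)$ for all $x,y\in J$ and all $t\in[0,1]$. (For $s=1$ this is ordinary convexity.) *)

(* Defs.v *)
From mathcomp Require Import all_boot all_order all_algebra.
From mathcomp Require Import all_classical all_reals all_analysis.
Set Implicit Arguments.
Unset Strict Implicit.
Unset Printing Implicit Defensive.
Import Order.TTheory GRing.Theory Num.Theory.
Local Open Scope classical_set_scope.
Local Open Scope ring_scope.

(* s-convexity in the second sense.  The notion is meant for 0 < s <= 1 and
   for an interval J included in [0, +oo[; these side conditions are left to
   the user of the definition.  Since 0 `^ s = 0 for s != 0, the weights at
   t = 0 and t = 1 are the expected ones. *)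
Definition s_convex (R : realType) (s : R) (J : set R) (h : R -> R) : Prop :=
  forall x y t : R, J x -> J y -> 0 <= t <= 1 ->
    h (t * x + (1 - t) * y) <= t `^ s * h x + (1 - t) `^ s * h y.

(* Main.v *)
Require Import Defs.
From mathcomp Require Import all_boot all_order all_algebra.
From mathcomp Require Import all_classical all_reals all_analysis.
From mathcomp Require Import measurable_realfun.
From mathcomp Require Import ring.
Import Order.TTheory GRing.Theory Num.Theory.
Import numFieldNormedType.Exports.
Local Open Scope classical_set_scope.
Local Open Scope ring_scope.

Set Implicit Arguments.
Unset Strict Implicit.
Unset Printing Implicit Defensive.

(** Every [x] of [[a, b]] is the convex combination [v * a + w * b] with
    [v = (b - x) / (b - a)] and [w = (x - a) / (b - a) = 1 - v].  Convexity of
    [f] and [s]-convexity of [g] therefore say that the two gaps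
    [v * f a + w * f b - f x] and [v `^ s * g a + w `^ s * g b - g x] are
    nonnegative.  Their product is nonnegative too, whatever the signs of [f]
    and [g], and expanding it gives, for each [x],
    [(v * f a + w * f b) * g x + (v `^ s * g a + w `^ s * g b) * f x
      <= f x * g x + (v * f a + w * f b) * (v `^ s * g a + w `^ s * g b)].
    This is [weighted_products_le].  Integrating it over [[a, b]] gives the
    theorem ([normalized_inequality]).

    The last product contains only powers of the weights: [v `^ (s + 1)] and
    [w `^ (s + 1)], both of mean [1 / (s + 2)], and the cross terms
    [v * w `^ s = w `^ s - w `^ (s + 1)] and [w * v `^ s = v `^ s - v `^ (s + 1)],
    of mean [1 / (s + 1) - 1 / (s + 2) = 1 / ((s + 1) * (s + 2))].  So the only
    integral to compute is that of a real power of a nonnegative affine function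
    ([has_Rintegral_affine_powR]).  Its exponent [s] may be below [1], and the
    base vanishes at an endpoint, where the power need not be differentiable
    and where [powR] jumps to the value [1] on negative arguments; continuity
    up to the endpoint is thus proved through the absolute value. *)

(** * Functions with a given integral *)

(** Keeping integrability and the value together lets linear combinations be
    integrated term by term without separate integrability side conditions. *)
Definition has_Rintegral (d : measure_display) (T : measurableType d)
    (R : realType) (mu : measure T R) (D : set T) (h : T -> R) (l : R) :=
  mu.-integrable D (EFin \o h) /\ \int[mu]_(x in D) h x = l.

Lemma has_RintegralD (d : measure_display) (T : measurableType d)
    (R : realType) (mu : measure T R) (D : set T) (h k : T -> R) (l m : R) :
  measurable D -> has_Rintegral mu D h l -> has_Rintegral mu D k m ->
  has_Rintegral mu D (fun x => h x + k x) (l + m).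
Proof.
move=> mD [hi <-] [ki <-]; split; last exact: RintegralD.
exact: (integrableD mD hi ki).
Qed.

Lemma has_RintegralZ (d : measure_display) (T : measurableType d)
    (R : realType) (mu : measure T R) (D : set T) (h : T -> R) (c l : R) :
  measurable D -> has_Rintegral mu D h l ->
  has_Rintegral mu D (fun x => c * h x) (c * l).
Proof.
move=> mD [hi <-]; split; last exact: RintegralZl.
exact: (integrableZl mD c hi).
Qed.

Lemma le_has_Rintegral (d : measure_display) (T : measurableType d)
    (R : realType) (mu : measure T R) (D : set T) (h k : T -> R) (l m : R) :
  measurable D -> has_Rintegral mu D h l -> has_Rintegral mu D k m ->
  (forall x, D x -> h x <= k x) -> l <= m.
Proof. by move=> mD [hi <-] [ki <-]; exact: le_Rintegral. Qed.

(** A continuous function is bounded on a segment. *)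
Lemma continuous_integrableM (R : realType) (a b : R) (u h : R -> R) :
  {within `[a, b], continuous u} ->
  lebesgue_measure.-integrable `[a, b] (EFin \o h) ->
  lebesgue_measure.-integrable `[a, b] (EFin \o (u \* h)).
Proof.
move=> cu hi.
have bu : [bounded u x | x in `[a, b] : set R].
  have [M [_ Mu]] :=
    compact_bounded (continuous_compact cu (@segment_compact R a b)).
  exists M; split; first exact: num_real.
  by move=> y /Mu yu x abx; apply: yu; exists x.
have mab : measurable (`[a, b] : set (measurableTypeR R)).
  exact: measurable_itv.
have mu' : measurable_fun (`[a, b] : set (measurableTypeR R)) u.
  exact: subspace_continuous_measurable_fun.
exact: (integrableMr mab mu' bu hi).
Qed.

(** * Real powers of affine functions *)

(** [powR ^~ r] itself is discontinuous at [0], since it equals [1] on negative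
    arguments. *)
Lemma continuous_normr_powR (R : realType) (r : R) : 0 < r ->
  continuous (fun x : R => `|x| `^ r).
Proof.
move=> r0 x; have [->|x0] := eqVneq x 0.
  apply/cvgrPdist_lt => e e0; rewrite normr0 powR0 ?gt_eqF//.
  near=> y; rewrite sub0r normrN ger0_norm ?powR_ge0//.
  have -> : e = (e `^ r^-1) `^ r.
    by rewrite -powRrM mulVf ?gt_eqF// powRr1// ltW.
  rewrite gt0_ltr_powR// ?nnegrE ?powR_ge0//.
  by near: y; apply: (@nbhs0_lt R R^o); rewrite powR_gt0.
apply: (@continuous_comp R^o R^o R^o Num.norm (@powR R ^~ r)).
  exact: norm_continuous.
apply/differentiable_continuous/derivable1_diffP/derivable_powR.
by rewrite in_itv/= andbT normr_gt0.
Unshelve. all: by end_near. Qed.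

Lemma within_continuous_powR (R : realType) (A : set R) (u : R -> R) (r : R) :
  0 < r -> continuous u -> (forall x, A x -> 0 <= u x) ->
  {within A, continuous (fun x => u x `^ r)}.
Proof.
move=> r0 cu u0; apply: (@subspace_eq_continuous _ _ _ (fun x => `|u x| `^ r)).
  by move=> x /[!inE] Ax; rewrite ger0_norm// u0.
apply: continuous_subspaceT => x.
apply: (@continuous_comp R^o R^o R^o u (fun y : R => `|y| `^ r)).
  exact: cu.
exact: continuous_normr_powR.
Qed.

Lemma continuous_affine (R : realType) (k d : R) :
  continuous (fun x : R => k * x + d).
Proof.
move=> x; apply: cvgD; last exact: cvg_cst.
by apply: cvgM; [exact: cvg_cst|exact: cvg_id].
Qed.

Lemma affine_gt0 (R : realType) (a b k d x : R) : k != 0 ->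
  0 <= k * a + d -> 0 <= k * b + d -> a < x < b -> 0 < k * x + d.
Proof.
move=> k_neq0 ua ub /andP[ax xb]; have [k0|k0|k0] := ltgtP k 0.
- by apply: (le_lt_trans ub); rewrite ltrD2r ltr_nM2l.
- by apply: (le_lt_trans ua); rewrite ltrD2r ltr_pM2l.
- by rewrite k0 eqxx in k_neq0.
Qed.

(** The antiderivative is [(k * x + d) `^ (r + 1) / (k * (r + 1))].  As [k != 0],
    an affine function that is nonnegative at both endpoints is positive inside,
    where [powR] is differentiable. *)
Lemma has_Rintegral_affine_powR (R : realType) (a b k d r : R) :
  a < b -> 0 < r -> k != 0 -> 0 <= k * a + d -> 0 <= k * b + d ->
  has_Rintegral (@lebesgue_measure R) `[a, b] (fun x => (k * x + d) `^ r)
    (((k * b + d) `^ (r + 1) - (k * a + d) `^ (r + 1)) / (k * (r + 1))).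
Proof.
move=> ab r0 k0 ua ub.
have u_gt0 x : a < x < b -> 0 < k * x + d by exact: affine_gt0.
have u_ge0 x : a <= x <= b -> 0 <= k * x + d.
  case/andP; rewrite le_eqVlt => /predU1P[<-//|ax].
  by rewrite le_eqVlt => /predU1P[->//|xb]; rewrite ltW// u_gt0// ax.
have cw p : 0 < p -> {within `[a, b], continuous (fun x => (k * x + d) `^ p)}.
  by move=> p0; apply: within_continuous_powR => //; exact: continuous_affine.
have r1 : 0 < r + 1 by rewrite addr_gt0.
have kr0 : k * (r + 1) != 0 by rewrite mulf_neq0// gt_eqF.
have dF x : x \in `]a, b[ ->
    is_derive x (1 : R) (fun x => (k * x + d) `^ (r + 1))
      (k * (r + 1) * (k * x + d) `^ r).
  rewrite in_itv/= => /u_gt0 ux.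
  have du : is_derive x (1 : R) (fun x => k * x + d) k.
    have dkd : is_derive x (1 : R) (k *: id + cst d) (k *: 1 + 0).
      exact: is_deriveD.
    by rewrite addr0 /GRing.scale/= mulr1 in dkd.
  have dp := is_derive1_powR (r + 1) ux.
  have := @is_derive1_comp _ _ (fun y => k * y + d) _ _ _ dp du.
  rewrite addrK /comp => dc.
  by apply: is_derive_eq dc _; rewrite /GRing.scale/=; ring.
have ui : lebesgue_measure.-integrable `[a, b]
    (EFin \o (fun x => (k * x + d) `^ r)).
  by apply: continuous_compact_integrable; [exact: segment_compact|exact: cw].
split => //; apply: (mulIf kr0); rewrite divfK// mulrC -RintegralZl//.
rewrite /Rintegral.
rewrite (@continuous_FTC2 _ _ (fun x => (k * x + d) `^ (r + 1)))//.
- by move=> x; apply: cvgM; [exact: cvg_cst|exact: (cw _ r0 x)].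
- have [_ Fa Fb] := (continuous_within_itvP _ ab).1 (cw _ r1).
  by split => // x /dF[].
- by move=> x /dF; rewrite derive1E => dx; rewrite derive_val.
Qed.

Lemma mulr_powR (R : realType) (t s : R) : 0 <= t -> 0 < s ->
  t * t `^ s = t `^ (s + 1).
Proof.
move=> t0 s0; have s1 : s + 1 != 0 by rewrite gt_eqF// addr_gt0.
by rewrite powRD ?(negPf s1)// powRr1// mulrC.
Qed.

(** * Barycentric coordinates on a segment *)

(** The weight of the left endpoint [a] in [x]. *)
Definition weightl (R : realType) (a b x : R) : R := (b - x) / (b - a).

(** The weight of the right endpoint [b] in [x]. *)
Definition weightr (R : realType) (a b x : R) : R := (x - a) / (b - a).

Lemma weightl_affine (R : realType) (a b : R) :
  weightl a b = (fun x => - (b - a)^-1 * x + b / (b - a)).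
Proof. by apply/funext => x; rewrite /weightl; ring. Qed.

Lemma weightr_affine (R : realType) (a b : R) :
  weightr a b = (fun x => (b - a)^-1 * x + - a / (b - a)).
Proof. by apply/funext => x; rewrite /weightr; ring. Qed.

Lemma weightl_ge0 (R : realType) (a b x : R) : a <= x <= b ->
  0 <= weightl a b x.
Proof.
by case/andP=> ax xb; rewrite divr_ge0// subr_ge0// (le_trans ax).
Qed.

Lemma weightr_ge0 (R : realType) (a b x : R) : a <= x <= b ->
  0 <= weightr a b x.
Proof.
by case/andP=> ax xb; rewrite divr_ge0// subr_ge0// (le_trans ax).
Qed.

Lemma onem_weightl (R : realType) (a b x : R) : a < b ->
  1 - weightl a b x = weightr a b x.
Proof.
by move=> ab; rewrite /weightl /weightr; field; rewrite subr_eq0 gt_eqF.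
Qed.

Lemma weightl_conv (R : realType) (a b x : R) : a < b ->
  weightl a b x * a + (1 - weightl a b x) * b = x.
Proof. by move=> ab; rewrite /weightl; field; rewrite subr_eq0 gt_eqF. Qed.

Lemma has_Rintegral_weightl_powR (R : realType) (a b r : R) : a < b -> 0 < r ->
  has_Rintegral (@lebesgue_measure R) `[a, b] (fun x => weightl a b x `^ r)
    ((b - a) / (r + 1)).
Proof.
move=> ab r0; have r1 : r + 1 != 0 by rewrite gt_eqF// addr_gt0.
have ba0 : b - a != 0 by rewrite subr_eq0 gt_eqF.
have wa : - (b - a)^-1 * a + b / (b - a) = 1 by field.
have wb : - (b - a)^-1 * b + b / (b - a) = 0 by field.
rewrite weightl_affine.
have := @has_Rintegral_affine_powR R a b (- (b - a)^-1) (b / (b - a)) r ab r0.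
rewrite wa wb powR1 powR0// oppr_eq0 invr_eq0 ler01 lexx => /(_ ba0 isT isT).
by congr has_Rintegral; field; rewrite ba0 r1.
Qed.

Lemma has_Rintegral_weightr_powR (R : realType) (a b r : R) : a < b -> 0 < r ->
  has_Rintegral (@lebesgue_measure R) `[a, b] (fun x => weightr a b x `^ r)
    ((b - a) / (r + 1)).
Proof.
move=> ab r0; have r1 : r + 1 != 0 by rewrite gt_eqF// addr_gt0.
have ba0 : b - a != 0 by rewrite subr_eq0 gt_eqF.
have wa : (b - a)^-1 * a + - a / (b - a) = 0 by field.
have wb : (b - a)^-1 * b + - a / (b - a) = 1 by field.
rewrite weightr_affine.
have := @has_Rintegral_affine_powR R a b (b - a)^-1 (- a / (b - a)) r ab r0.
rewrite wa wb powR1 powR0// invr_eq0 ler01 lexx => /(_ ba0 isT isT).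
by congr has_Rintegral; field; rewrite ba0 r1.
Qed.

(** * The inequality *)

Lemma convex_function_segment (R : realType) (a b t : R) (f : R -> R) :
  a <= b -> convex_function (`[a, b]%classic : set R) f -> 0 <= t <= 1 ->
  f (t * a + (1 - t) * b) <= t * f a + (1 - t) * f b.
Proof.
move=> ab cf /andP[t0 t1].
have := cf (Itv01 t0 t1) a b.
by rewrite !inE /= !in_itv/= !lexx ab => /(_ erefl erefl).
Qed.

(** The difference of the two sides is the product of the convexity gaps of [f]
    and [g] at [x].  The right-hand side is arranged as a linear combination of
    powers of the weights, ready for integration. *)
Lemma weighted_products_le (R : realType) (a b s x : R) (f g : R -> R) :
  a < b -> 0 < s -> a <= x <= b ->
  convex_function (`[a, b]%classic : set R) f -> s_convex s `[a, b] g ->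
  let v := weightl a b x in let w := weightr a b x in
  f a * (v * g x) + f b * (w * g x)
    + g a * (v `^ s * f x) + g b * (w `^ s * f x)
  <= f x * g x
     + (f a * g a * v `^ (s + 1) + f b * g b * w `^ (s + 1)
        + (f a * g b * (w `^ s + -1 * w `^ (s + 1))
           + f b * g a * (v `^ s + -1 * v `^ (s + 1)))).
Proof.
move=> ab s0 xab cf cg /=; set v := weightl a b x; set w := weightr a b x.
have v0 : 0 <= v by exact: weightl_ge0.
have w0 : 0 <= w by exact: weightr_ge0.
have wE : 1 - v = w by exact: onem_weightl.
have v01 : 0 <= v <= 1 by rewrite v0 -subr_ge0 wE.
have fgap := convex_function_segment (ltW ab) cf v01.
have ggap := cg a b v; rewrite /= !in_itv/= !lexx ltW// in ggap.
move: ggap => /(_ erefl erefl v01); rewrite weightl_conv// wE => ggap.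
rewrite weightl_conv// wE in fgap.
rewrite -subr_ge0 -!mulr_powR//.
have := mulr_ge0 (etrans (subr_ge0 _ _) fgap) (etrans (subr_ge0 _ _) ggap).
by apply: etrans; congr (0 <= _); rewrite -wE; ring.
Qed.

Lemma normalized_inequality (R : realType) (a b s : R) (f g : R -> R) :
  let mu := @lebesgue_measure R in
  a < b -> 0 < s ->
  mu.-integrable `[a, b] (EFin \o f) ->
  mu.-integrable `[a, b] (EFin \o g) ->
  mu.-integrable `[a, b] (EFin \o (f \* g)) ->
  convex_function (`[a, b]%classic : set R) f -> s_convex s `[a, b] g ->
  f a * (\int[mu]_(x in `[a, b]) (weightl a b x * g x))
  + f b * (\int[mu]_(x in `[a, b]) (weightr a b x * g x))
  + g a * (\int[mu]_(x in `[a, b]) (weightl a b x `^ s * f x))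
  + g b * (\int[mu]_(x in `[a, b]) (weightr a b x `^ s * f x))
  <= \int[mu]_(x in `[a, b]) (f x * g x)
     + (b - a) * ((f a * g a + f b * g b) / (s + 2)
                  + (f a * g b + f b * g a) / ((s + 1) * (s + 2))).
Proof.
move=> mu ab s0 fi gi fgi cf cg.
have s1 : 0 < s + 1 by rewrite addr_gt0.
have mab : measurable (`[a, b] : set (measurableTypeR R)).
  exact: measurable_itv.
have cl : continuous (weightl a b).
  by rewrite weightl_affine; exact: continuous_affine.
have cr : continuous (weightr a b).
  by rewrite weightr_affine; exact: continuous_affine.
have cw (u : R -> R) : continuous u -> {within `[a, b], continuous u}.
  by move=> cu; apply: continuous_subspaceT.
have cls : {within `[a, b], continuous (fun x => weightl a b x `^ s)}.
  by apply: within_continuous_powR => // x; exact: weightl_ge0.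
have crs : {within `[a, b], continuous (fun x => weightr a b x `^ s)}.
  by apply: within_continuous_powR => // x; exact: weightr_ge0.
have hM (u h : R -> R) : {within `[a, b], continuous u} ->
    mu.-integrable `[a, b] (EFin \o h) ->
    has_Rintegral mu `[a, b] (fun x => u x * h x)
      (\int[mu]_(x in `[a, b]) (u x * h x)).
  by move=> cu hi; split => //; exact: continuous_integrableM.
have hfg : has_Rintegral mu `[a, b] (fun x => f x * g x)
   (\int[mu]_(x in `[a, b]) (f x * g x)) by [].
have hcross (u : R -> R) :
    has_Rintegral mu `[a, b] (fun x => u x `^ s) ((b - a) / (s + 1)) ->
    has_Rintegral mu `[a, b] (fun x => u x `^ (s + 1)) ((b - a) / (s + 1 + 1)) ->
  has_Rintegral mu `[a, b] (fun x => u x `^ s + -1 * u x `^ (s + 1))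
    ((b - a) / (s + 1) + -1 * ((b - a) / (s + 1 + 1))).
  by move=> h1 h2; exact/(has_RintegralD mab h1)/(has_RintegralZ _ mab h2).
have hl1 := has_Rintegral_weightl_powR ab s1.
have hr1 := has_Rintegral_weightr_powR ab s1.
have hl := hcross _ (has_Rintegral_weightl_powR ab s0) hl1.
have hr := hcross _ (has_Rintegral_weightr_powR ab s0) hr1.
have hL := has_RintegralD mab (has_RintegralD mab (has_RintegralD mab
  (has_RintegralZ (f a) mab (hM _ _ (cw _ cl) gi))
  (has_RintegralZ (f b) mab (hM _ _ (cw _ cr) gi)))
  (has_RintegralZ (g a) mab (hM _ _ cls fi)))
  (has_RintegralZ (g b) mab (hM _ _ crs fi)).
have hR := has_RintegralD mab hfg (has_RintegralD mab
  (has_RintegralD mab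
    (has_RintegralZ (f a * g a) mab hl1) (has_RintegralZ (f b * g b) mab hr1))
  (has_RintegralD mab
    (has_RintegralZ (f a * g b) mab hr) (has_RintegralZ (f b * g a) mab hl))).
(* [hL] and [hR] carry the sides of [weighted_products_le] as integrands. *)
apply: le_trans (le_has_Rintegral mab hL hR _) _ => [x|].
  by rewrite /= in_itv/= => xab; exact: weighted_products_le.
rewrite lerD2l le_eqVlt; apply/orP; left; apply/eqP; field.
by rewrite !gt_eqF// ?addr_gt0.
Qed.

Theorem theorem2 (R : realType) (I : set R) (a b s : R) (f g : R -> R)
  (I_interval : is_interval I) (I_ge0 : I `<=` `[0, +oo[)
  (Ia : I a) (Ib : I b) (ab : a < b)
  (s_gt0 : 0 < s) (s_le1 : s <= 1)
  (f_int : lebesgue_measure.-integrable `[a, b] (EFin \o f))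
  (g_int : lebesgue_measure.-integrable `[a, b] (EFin \o g))
  (fg_int : lebesgue_measure.-integrable `[a, b] (EFin \o (f \* g)))
  (f_convex : convex_function (`[a, b]%classic : set R) f)
  (g_sconvex : s_convex s `[a, b] g) :
  let mu := @lebesgue_measure R in
  let M := f a * g a + f b * g b in
  let N := f a * g b + f b * g a in
  f a / (b - a) ^+ 2 * (\int[mu]_(x in `[a, b]) ((b - x) * g x))
  + f b / (b - a) ^+ 2 * (\int[mu]_(x in `[a, b]) ((x - a) * g x))
  + g a / (b - a) `^ (s + 1) * (\int[mu]_(x in `[a, b]) ((b - x) `^ s * f x))
  + g b / (b - a) `^ (s + 1) * (\int[mu]_(x in `[a, b]) ((x - a) `^ s * f x))
  <= (b - a)^-1 * (\int[mu]_(x in `[a, b]) (f x * g x))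
     + M / (s + 2) + N / ((s + 1) * (s + 2)).
Proof.
rewrite /=; set mu := @lebesgue_measure R.
set M := f a * g a + f b * g b; set N := f a * g b + f b * g a.
have ba_gt0 : 0 < b - a by rewrite subr_gt0.
have ba_ge0 := ltW ba_gt0.
have ba0 : b - a != 0 by rewrite gt_eqF.
have bas0 : (b - a) `^ s != 0 by rewrite gt_eqF// powR_gt0.
have cl : continuous (weightl a b).
  by rewrite weightl_affine; exact: continuous_affine.
have cr : continuous (weightr a b).
  by rewrite weightr_affine; exact: continuous_affine.
(* The equation holds on the segment only: a power of a product splits into
   the powers of its factors when these are nonnegative. *)
have scale (u h k : R -> R) c : {within `[a, b], continuous u} ->
    mu.-integrable `[a, b] (EFin \o h) ->
    (forall x, a <= x <= b -> k x = c * u x) ->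
    \int[mu]_(x in `[a, b]) (k x * h x) =
    c * \int[mu]_(x in `[a, b]) (u x * h x).
  move=> cu hi kE; rewrite -RintegralZl//; last exact: continuous_integrableM.
  by apply: eq_Rintegral => x; rewrite inE/= in_itv/= => /kE ->; rewrite mulrA.
rewrite (scale (weightl a b) g (fun x => b - x) (b - a))//; last 2 first.
- by apply: continuous_subspaceT.
- by move=> x _; rewrite /weightl mulrC divfK.
rewrite (scale (weightr a b) g (fun x => x - a) (b - a))//; last 2 first.
- by apply: continuous_subspaceT.
- by move=> x _; rewrite /weightr mulrC divfK.
rewrite (scale (fun x => weightl a b x `^ s) f
  (fun x => (b - x) `^ s) ((b - a) `^ s))//; last 2 first.
- by apply: within_continuous_powR => // x; exact: weightl_ge0.
- move=> x /weightl_ge0 v0 /=.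
  by rewrite -powRM// /weightl [in RHS]mulrC divfK.
rewrite (scale (fun x => weightr a b x `^ s) f
  (fun x => (x - a) `^ s) ((b - a) `^ s))//; last 2 first.
- by apply: within_continuous_powR => // x; exact: weightr_ge0.
- move=> x /weightr_ge0 w0 /=.
  by rewrite -powRM// /weightr [in RHS]mulrC divfK.
rewrite -mulr_powR//.
have := normalized_inequality ab s_gt0 f_int g_int fg_int f_convex g_sconvex.
rewrite -(ler_pM2l (x := (b - a)^-1)) ?invr_gt0//.
rewrite -/mu -/M -/N; set V := Rintegral _ _ _; set W := Rintegral _ _ _.
set Vs := Rintegral _ _ _; set Ws := Rintegral _ _ _.
set FG := Rintegral _ _ _ => le_norm.
have -> : (b - a)^-1 * FG + M / (s + 2) + N / ((s + 1) * (s + 2)) =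
    (b - a)^-1 * (FG + (b - a) * (M / (s + 2) + N / ((s + 1) * (s + 2)))).
  by rewrite -addrA [RHS]mulrDr mulKf//.
apply: le_trans _ le_norm; rewrite le_eqVlt; apply/orP; left; apply/eqP.
by field; rewrite ba0 bas0.
Qed.
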